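(* Let $f\colon X\to Y$ be a function between admissibly represented countably based $T_0$-spaces and let $\alpha$ be a countable ordinal with $1\leq\alpha$. Then the following are equivalent: (i) $f$ is $j_\alpha$-realizable; (ii) $Lev(f)\leq\alpha$; (iii) $f$ is $\mathcal{D}_\alpha$-piecewise continuous.
   Context: $\omega^\omega$ is Baire space; $\subseteq$ in $F\colon\subseteq A\to B$ indicates a partial function. Equations between compositions of partial functions are equalities of partial functions (same domain, same values). A partial function on $\omega^\omega$ is continuous if it is continuous on its domain with the subspace topology. A representation of a set $X$ is a surjective partial function $\rho\colon\subseteq\omega^\omega\to X$. A representation $\rho$ of a topological space $X$ is admissible if $\rho$ is continuous and for every continuous $g\colon\subseteq\omega^\omega\to X$ there is a continuous $G\colon\subseteq\omega^\omega\to\omega^\omega$ with $g=\rho\circ G$. $X$ and $Y$ carry admissible representations $\rho_X,\rho_Y$. $\langle\cdots\rangle_{n\in\omega}\colon(\omega^\omega)^\omega\to\omega^\omega$ is a fixed (computable) encoding of countable sequences of elements of $\omega^\omega$ as elements of $\omega^\omega$, for example the homeomorphism with $\langle\xi_n\rangle_{n\in\omega}(\langle n,m\rangle)=\xi_n(m)$ for a computable bijection $\langle\cdot,\cdot\rangle\colon\omega^2\to\omega$. For a countable ordinal $\alpha$, $\langle\cdot\rangle_\alpha\colon\alpha\to\omega$ is a fixed (injective) encoding of the ordinals less than $\alpha$ as natural numbers, and $\langle\beta\rangle_\alpha\diamond\xi$ is the element of $\omega^\omega$ obtained by prepending the encoding of $\beta$ to $\xi$. The jump operator $j_\alpha\colon\subseteq\omega^\omega\to\omega^\omega$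 has domain the set of all $\langle\langle\beta_n\rangle_\alpha\diamond\xi_n\rangle_{n\in\omega}$ such that $(\forall n)(\alpha>\beta_n\geq\beta_{n+1})$ and $(\forall n)(\xi_n\neq\xi_{n+1}\Rightarrow\beta_n\neq\beta_{n+1})$, and $j_\alpha(\langle\langle\beta_n\rangle_\alpha\diamond\xi_n\rangle_{n\in\omega})=\lim_n\xi_n$. $f\colon X\to Y$ is $j_\alpha$-realizable if there is a partial continuous $F\colon\subseteq\omega^\omega\to\omega^\omega$ with $f\circ\rho_X=\rho_Y\circ j_\alpha\circ F$. Let $cl(\cdot)$ be the closure operator on $X$. Define $\mathcal{L}_\alpha(f)\subseteq X$ recursively: $\mathcal{L}_0(f)=X$; $\mathcal{L}_{\alpha+1}(f)=cl(\{x\in\mathcal{L}_\alpha(f)\mid f|_{\mathcal{L}_\alpha(f)}\text{ is discontinuous at }x\})$; $\mathcal{L}_\alpha(f)=\bigcap_{\beta<\alpha}\mathcal{L}_\beta(f)$ for $\alpha$ a limit ordinal. $Lev(f)=\min\{\alpha\mid\mathcal{L}_\alpha(f)=\emptyset\}$ if such $\alpha$ exists, and $Lev(f)=\infty$ otherwise (where $\infty$ is larger than every ordinal). For $1\leq\alpha<\omega_1$, a total function $f\colon X\to Y$ is $\mathcal{D}_\alpha$-piecewise continuous iff there is a family $\{U_\beta\}_{\beta<\alpha}$ of open subsets of $X$ such that $X=\bigcup_{\beta<\alpha}\mathcal{D}_\alpha(U_\beta)$ and $f|_{\mathcal{D}_\alpha(U_\beta)}\colon\mathcal{D}_\alpha(U_\beta)\to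 Y$ is continuous for all $\beta<\alpha$, where $\mathcal{D}_\alpha(U_\beta)=U_\beta\setminus\bigcup_{\gamma<\beta}U_\gamma$. *)

(* Defs.v *)
From HB Require Import structures.
From mathcomp Require Import all_boot all_order all_algebra.
From mathcomp Require Import all_classical all_reals all_analysis.

Set Implicit Arguments.
Unset Strict Implicit.
Unset Printing Implicit Defensive.

Import Order.TTheory.

Local Open Scope classical_set_scope.
Local Open Scope order_scope.

Definition baire : Type := prod_topology (fun _ : nat => nat).

HB.instance Definition _ := Pointed.on baire.
HB.instance Definition _ := Nbhs.on baire.
HB.instance Definition _ := Topological.on baire.

(* A partial function from A to B is a function A -> option B; [None] means
   "undefined", Leibniz equality is equality of domains and values, and
   [obind g \o f] is the composition of partial functions. *)
Definition pdom (A B : Type) (F : A -> option B) : set A :=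
  [set x | exists y, F x = Some y].

Definition ppreimage (A B : Type) (F : A -> option B) (V : set B) : set A :=
  [set x | exists2 y, F x = Some y & V y].

(* Continuity on the domain, for the subspace topology of the domain. *)
Definition pcontinuous (A B : topologicalType) (F : A -> option B) : Prop :=
  forall V : set B, open V ->
    exists2 U : set A, open U & ppreimage F V = U `&` pdom F.

Definition representation (X : Type) (rho : baire -> option X) : Prop :=
  forall x, exists p, rho p = Some x.

Definition admissible (X : topologicalType) (rho : baire -> option X) : Prop :=
  [/\ representation rho,
      pcontinuous rho
    & forall g : baire -> option X, pcontinuous g ->
      exists2 G : baire -> option baire,
        pcontinuous G & g = obind rho \o G].

(* Encodings of sequences of elements of Baire space: homeomorphisms from the
   countable power (with the product topology) onto Baire space. *)
Definition baire_seq : Type := prod_topology (fun _ : nat => baire).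

HB.instance Definition _ := Pointed.on baire_seq.
HB.instance Definition _ := Nbhs.on baire_seq.
HB.instance Definition _ := Topological.on baire_seq.

Definition seq_encoding (enc : baire_seq -> baire) : Prop :=
  continuous enc /\
  exists dec : baire -> baire_seq,
    [/\ cancel enc dec, cancel dec enc & continuous dec].

Definition prepend (k : nat) (xi : baire) : baire :=
  fun n => if n is m.+1 then xi m else k.

(* Ordinals are the elements of a well-ordered type [O], which stands for an
   arbitrary initial segment of the class of ordinals: b : O is identified with
   the order type of [set c | c < b]. *)
Section Ordinals.
Context {d : Order.disp_t} {O : orderType d}.

Definition well_ordered : Prop := well_founded (fun a b : O => a < b).

Definition ord_zero (a : O) : Prop := forall b, a <= b.

Definition ord_succ (b a : O) : Prop :=
  b < a /\ forall c, b < c -> a <= c.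

End Ordinals.
Arguments well_ordered {d} O.

Section Jump.
Context {d : Order.disp_t} {O : orderType d}.
Variables (enc : baire_seq -> baire) (a : O) (code : O -> nat).

Definition jump_graph (p q : baire) : Prop :=
  exists (b : nat -> O) (xi : baire_seq),
    [/\ forall n, b n < a /\ b n.+1 <= b n,
        forall n, xi n <> xi n.+1 -> b n <> b n.+1,
        p = enc (fun n => prepend (code (b n)) (xi n))
      & xi @ \oo --> q].

(* The partial function with the above graph.  The sequence [b] is eventually
   constant, so [xi] converges whenever the first two conditions hold, and
   [jump_graph] is functional when [enc] is injective and [code] is injective
   on the ordinals below [a]. *)
Definition jump (p : baire) : option baire :=
  xget None [set Some q | q in jump_graph p].

Definition jump_realizable (X Y : topologicalType)
    (rhoX : baire -> option X) (rhoY : baire -> option Y) (f : X -> Y) : Prop :=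
  exists2 F : baire -> option baire,
    pcontinuous F & omap f \o rhoX = obind rhoY \o (obind jump \o F).

End Jump.

Section Level.
Context {X Y : topologicalType} (f : X -> Y).

(* The points of [A] at which the restriction of [f] to [A] is discontinuous. *)
Definition discontinuities (A : set X) : set X :=
  [set x | A x /\ ~ {for x, continuous (f : subspace A -> Y)}].

Context {d : Order.disp_t} {O : orderType d} (wf : well_ordered O).

Definition level_step (a : O) (L : forall b, b < a -> set X) : set X :=
  if pselect (ord_zero a) then [set: X] else
  match pselect (exists b, ord_succ b a) with
  | left h => let: exist b sba := cid h in
              closure (discontinuities (L b sba.1))
  | right _ => [set x | forall b (ba : b < a), L b ba x]
  end.

Definition level : O -> set X := Fix wf (fun=> set X) level_step.

Lemma levelE a : level a = @level_step a (fun b _ => level b).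
Proof.
rewrite /level Fix_eq// => x F G FG; congr (level_step _).
apply: functional_extensionality_dep => b.
by apply: functional_extensionality_dep => bx; exact: FG.
Qed.

Lemma level_zero a : ord_zero a -> level a = [set: X].
Proof. by rewrite levelE /level_step; case: pselect. Qed.

Lemma level_succ b a : ord_succ b a ->
  level a = closure (discontinuities (level b)).
Proof.
move=> [ba bP]; rewrite levelE /level_step; case: (pselect (ord_zero a)) => [a0|a0] /=.
  by have := a0 b; rewrite leNgt ba.
case: (pselect (exists _, _)) => [h|[]]; last by exists b.
case: cid => c [/= ca cP]; congr (closure (discontinuities (level _))).
apply: le_anti; rewrite !leNgt; apply/andP; split; apply/negP.
  by move=> /bP; rewrite leNgt ca.
by move=> /cP; rewrite leNgt ba.
Qed.

Lemma level_limit a : ~ ord_zero a -> ~ (exists b, ord_succ b a) ->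
  level a = \bigcap_(b in [set b | b < a]) level b.
Proof. by move=> a0 aS; rewrite levelE /level_step; do 2 case: pselect. Qed.

(* The least a with [level a = set0].  [None] stands for infinity, a value larger
   than every element of [O]; levels beyond [O] are irrelevant to comparisons
   with elements of [O]. *)
Definition Lev : option O :=
  xget None [set Some a | a in
    [set a | level a = set0 /\ forall b, level b = set0 -> a <= b]].

Definition Lev_le (a : O) : Prop := exists2 b, Lev = Some b & b <= a.

End Level.

Section Piecewise.
Context {X Y : topologicalType} {d : Order.disp_t} {O : orderType d}.

Definition diff_piece (U : O -> set X) (b : O) : set X :=
  U b `\` \bigcup_(c in [set c | c < b]) U c.

Definition diff_piecewise_continuous (a : O) (f : X -> Y) : Prop :=
  exists U : O -> set X,
    [/\ forall b, b < a -> open (U b),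
        [set: X] = \bigcup_(b in [set b | b < a]) diff_piece U b
      & forall b, b < a -> {within diff_piece U b, continuous f}].

End Piecewise.

(* Main.v *)
Require Import Defs.
From mathcomp Require Import all_boot all_order all_algebra.
From mathcomp Require Import all_classical all_reals all_analysis.
Import Order.TTheory.
Local Open Scope classical_set_scope.
Local Open Scope order_scope.

(* The levels and the pieces determine each other: U_b is the complement of the
   level of b+1, and conversely the level of b avoids U_c for every c < b.

   From pieces to a realizer: on a name p the ordinal b_n is the least index b
   such that a prefix of p of length N + n forces the point into U_b, and xi_n
   is the value at p of a realizer of f on the piece D_b for b = b_n.  A realizer
   for D_b must give an answer on all names of points of U_b; it is extended from
   D_b by precomposing with a retraction of Baire space onto a closed subset.

   From a realizer to levels: names may be taken in an open representation, and
   then the ordinals output on a name of a point of the level of b are all at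
   least b.  For if b is reached on a name of a point of that level, it is reached
   on a whole neighborhood of names; on the names of points of the level it can
   never be left, so the current approximation is the limit and depends
   continuously on the name, which makes the restriction of f continuous. *)

(** * Baire space and partial continuity *)

Lemma cvg_prod_topology {I : Type} {T : I -> topologicalType}
    (F : set_system (prod_topology T)) (FF : Filter F) (t : prod_topology T) :
  F --> t <-> forall i, (fun s : prod_topology T => s i) @ F --> t i.
Proof.
split=> [/cvg_sup Ft i V|Ft].
  rewrite nbhsE => -[W [oW Wt] WV]; apply: (Ft i).
  exists ((fun s : prod_topology T => s i) @^-1` W).
  by split => [|//|s /WV]; first exists W.
apply/cvg_sup => i A [_ [[B oB <-] Bt] sBA]; apply: filterS sBA _.
by apply: Ft; apply: open_nbhs_nbhs.
Qed.

Definition agree (n : nat) (p q : baire) := forall i, (i < n)%N -> p i = q i.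

Lemma nbhs_cylinder (p : baire) n : nbhs p (agree n p).
Proof.
have nth_nbhs i : \forall q \near p, (p : baire) i = (q : baire) i.
  have /cvg_prod_topology /(_ i [set p i] (discrete_set1 (p i : nat))) :
    nbhs p --> p by [].
  by rewrite nbhs_simpl; apply: filterS => q /esym.
elim: n => [|n IHn]; first by apply: (@filterE _ (nbhs p)) => q i.
near=> q => i; rewrite ltnS leq_eqVlt => /predU1P[->|]; last first.
  by apply: (near IHn q).
by apply: (near (nth_nbhs n) q).
Unshelve. all: by end_near. Qed.

Lemma nbhs_baireP (p : baire) (V : set baire) :
  nbhs p V <-> exists n, agree n p `<=` V.
Proof.
split=> [|[n nV]]; last exact: filterS nV (nbhs_cylinder p n).
pose F := filter_from [set: nat] (fun n => agree n p).
have FF : Filter F.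
  apply: filter_from_filter; first by exists 0%N.
  move=> i j _ _; exists (maxn i j) => // q pq.
  by split=> k ki; apply: pq; rewrite (leq_trans ki)// (leq_maxl, leq_maxr).
have Fp : F --> p.
  apply/cvg_prod_topology => i W /nbhs_singleton Wp.
  by exists i.+1 => // q pq; rewrite /= -pq.
by move=> /Fp [n _ nV]; exists n.
Qed.

Lemma agreeS m n {p q} : (m <= n)%N -> agree n p q -> agree m p q.
Proof. by move=> mn pq i im; apply: pq; apply: leq_trans mn. Qed.

Lemma agree_sym n {p q} : agree n p q -> agree n q p.
Proof. by move=> pq i /pq. Qed.

Lemma agree_trans n {p q r} : agree n p q -> agree n q r -> agree n p r.
Proof. by move=> pq qr i ni; rewrite pq // qr. Qed.

Lemma baire_hausdorff : hausdorff_space baire.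
Proof.
move=> p q pq; apply/funext => i.
have [r [pr qr]] := pq _ _ (nbhs_cylinder p i.+1) (nbhs_cylinder q i.+1).
by rewrite pr // qr.
Qed.

Lemma prepend_continuous k : continuous (prepend k).
Proof.
move=> p V /nbhs_baireP[n nV]; apply/nbhs_baireP; exists n => q pq; apply: nV.
by case=> [//|i] /ltnW ni; exact: pq.
Qed.

Definition tail (p : baire) : baire := fun n => p n.+1.

Lemma tail_continuous : continuous tail.
Proof.
move=> p V /nbhs_baireP[n nV]; apply/nbhs_baireP; exists n.+1 => q pq.
by apply: nV => i ni; exact: pq.
Qed.

(** Points outside the domain satisfy the right-hand condition vacuously, so neighborhoods in [A]
    suffice and no subspace topology has to be carried along. *)
Lemma pcontinuousP {A B : topologicalType} (F : A -> option B) :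
  pcontinuous F <-> forall p y, F p = Some y -> forall V, nbhs y V ->
    \forall q \near p, forall z, F q = Some z -> V z.
Proof.
split=> [cF p y Fp V yV|cF V oV].
  have [U oU UE] := cF _ (open_interior V).
  have : (U `&` pdom F) p by rewrite -UE; exists y.
  case=> Up _; have := open_nbhs_nbhs (conj oU Up); apply: filterS => q Uq z Fq.
  have : (U `&` pdom F) q by split=> //; exists z.
  by rewrite -UE => -[z']; rewrite Fq => -[<-] /interior_subset.
exists ([set q | forall z, F q = Some z -> V z]°); first exact: open_interior.
apply/seteqP; split=> p.
  move=> [y Fp Vy]; split; last by exists y.
  by apply: (cF _ _ Fp); exact: open_nbhs_nbhs.
by move=> [/interior_subset/= FV [y Fp]]; exists y => //; exact: FV.
Qed.

Lemma pcontinuous_comp {A B C : topologicalType} (F : A -> option B)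
    (G : B -> option C) :
  pcontinuous F -> pcontinuous G -> pcontinuous (obind G \o F).
Proof.
move=> /pcontinuousP cF /pcontinuousP cG; apply/pcontinuousP => p z /=.
case Fp : (F p) => [y|//] /= Gy V zV.
have := cF _ _ Fp _ (cG _ _ Gy _ zV); apply: filterS => q FV z'.
by case Fq : (F q) => [y'|//] /=; apply: FV.
Qed.

Lemma continuous_pcontinuous {A B : topologicalType} (D : set A) (h : A -> B)
    (F : A -> option B) :
  (forall p, F p = if p \in D then Some (h p) else None) ->
  (forall p, D p -> h @ within D (nbhs p) --> h p) -> pcontinuous F.
Proof.
move=> FE hD; apply/pcontinuousP => p y; rewrite FE.
case: ifPn => // /set_mem Dp [<-] V /(hD _ Dp) hV.
have {}hV : nbhs p [set q | D q -> V (h q)] := hV.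
apply: filterS hV => q DV z; rewrite FE.
by case: ifPn => // /set_mem /DV /= ? [<-].
Qed.

(** * Levels and difference pieces *)

Section WellOrder.
Context {d : Order.disp_t} {O : orderType d} (wf : well_ordered O).

Lemma wo_least (P : set O) :
  P !=set0 -> exists b, P b /\ forall c, P c -> b <= c.
Proof.
move=> [b Pb]; apply: contrapT => nleast; elim/(well_founded_ind wf): b Pb.
move=> b IHb Pb; apply: nleast; exists b; split=> // c Pc.
by rewrite leNgt; apply/negP => /IHb /(_ Pc).
Qed.

Lemma ord_succ_ex {b a : O} : b < a -> exists2 s, ord_succ b s & s <= a.
Proof.
move=> ba; have [s [bs sP]] : exists s, b < s /\ forall c, b < c -> s <= c.
  by apply: (wo_least [set c | b < c]); exists a.
by exists s; [split|exact: sP].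
Qed.

Definition least (b0 : O) (P : set O) : O :=
  xget b0 [set b | P b /\ forall c, P c -> b <= c].

Lemma leastP {b0} {P : set O} : P !=set0 ->
  P (least b0 P) /\ forall c, P c -> least b0 P <= c.
Proof. by move=> /wo_least; exact: (xgetPex b0). Qed.

Lemma least_unique {b0} {P : set O} b :
  P b -> (forall c, P c -> b <= c) -> least b0 P = b.
Proof.
move=> Pb bP; have [Pl lP] := @leastP b0 P (ex_intro _ b Pb).
by apply/le_anti/andP; split; [exact: lP|exact: bP].
Qed.

End WellOrder.

Lemma subspace_continuous_atP {X Y : topologicalType} (f : X -> Y) (A : set X)
    (x : X) : A x ->
  {for x, continuous (f : subspace A -> Y)} <->
  f @ within A (nbhs x) --> f x.
Proof.
by move=> Ax; rewrite /prop_for /continuous_at; case: _ / (nbhs_subspaceP A x).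
Qed.

Section LevelTheory.
Context {X Y : topologicalType} (f : X -> Y).
Context {d : Order.disp_t} {O : orderType d} (wf : well_ordered O).
Local Notation level := (level f wf).

(** [P] takes the set as a separate argument so that each case sees the level already unfolded. *)
Lemma level_ind (P : O -> set X -> Prop) :
  (forall a, ord_zero a -> P a [set: X]) ->
  (forall b a, ord_succ b a -> P b (level b) ->
     P a (closure (discontinuities f (level b)))) ->
  (forall a, ~ ord_zero a -> ~ (exists b, ord_succ b a) ->
     (forall b, b < a -> P b (level b)) ->
     P a (\bigcap_(b in [set b | b < a]) level b)) ->
  forall a, P a (level a).
Proof.
move=> P0 PS PL; elim/(well_founded_ind wf) => a IHa.
have [a0|an0] := pselect (ord_zero a); first by rewrite level_zero //; exact: P0.
have [[b ba]|aS] := pselect (exists b, ord_succ b a).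
  by rewrite (level_succ _ _ ba); apply: PS => //; apply: IHa; case: ba.
by rewrite level_limit //; apply: PL.
Qed.

Lemma level_closed a : closed (level a).
Proof.
apply: (level_ind (fun=> closed)) => [b _|b c _ _|c _ _ IH].
- exact: closedT.
- exact: closed_closure.
- exact: closed_bigI.
Qed.

Lemma closure_discontinuities a :
  closure (discontinuities f (level a)) `<=` level a.
Proof. by apply: subset_trans (@level_closed a); apply: closureS => x []. Qed.

Lemma level_anti {b a} : b <= a -> level a `<=` level b.
Proof.
rewrite le_eqVlt => /predU1P[->//|]; move: b.
apply: (level_ind (fun a L => forall b, b < a -> L `<=` level b)) a.
- by move=> a a0 b; rewrite ltNge a0.
- move=> c a [_ cP] IHc b ba.
  apply: subset_trans (@closure_discontinuities c) _.
  have : b <= c by rewrite leNgt; apply/negP => /cP; rewrite leNgt ba.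
  by rewrite le_eqVlt => /predU1P[->//|]; exact: IHc.
- by move=> a _ _ _ b ba x; apply.
Qed.

(** Levels decrease, so once one is empty all later ones are; this removes [Lev] from the rest of
    the proof. *)
Lemma Lev_leP a : Lev_le f wf a <-> level a = set0.
Proof.
rewrite /Lev_le /Lev; split=> [[b] + ba|a0].
  case: xgetP => // _ -> [c [c0 _] <-] [cb]; subst c.
  by apply/seteqP; split=> // x /(level_anti ba); rewrite c0.
have [b [b0 bP]] := wo_least wf [set a | level a = set0] (ex_intro _ a a0).
exists b; last exact: bP.
apply: xget_unique; first by exists b.
move=> _ [c [c0 cP] <-]; congr Some; apply/le_anti/andP.
by split; [exact: cP|exact: bP].
Qed.

(* The first level missing x is neither zero nor a limit. *)
Lemma level_exit {a x} : ~ level a x ->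
  exists b s, [/\ ord_succ b s, s <= a, level b x & ~ level s x].
Proof.
move=> ax; have [s [sx sP]] := wo_least wf [set s | ~ level s x]
  (ex_intro _ a ax).
have [s0|s0] := pselect (ord_zero s); first by case: sx; rewrite level_zero.
have [[b bs]|sS] := pselect (exists b, ord_succ b s); last first.
  case: sx; rewrite level_limit // => b /= bs; apply: contrapT => /sP.
  by rewrite leNgt bs.
exists b, s; split=> //; first exact: sP.
by apply: contrapT => /sP; rewrite leNgt; case: bs => ->.
Qed.

Lemma level_piecewise a :
  level a = set0 -> diff_piecewise_continuous a f.
Proof.
(* The successor of [b] is given by a relation only: there is at most one, and if [b] is the largest
   element of [O] the union is empty. *)
move=> a0; pose U b := \bigcup_(s in [set s | ord_succ b s]) ~` level s.
have UE b s : ord_succ b s -> U b = ~` level s.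
  move=> bs; apply/seteqP; split=> [x [t bt]|x sx]; last by exists s.
  suff -> : t = s by [].
  case: bs bt => bs sP [bt tP]; apply/le_anti/andP.
  by split; [exact: tP|exact: sP].
(* A point that left the levels at some [s <= b], with [s] the successor of [c], already lies in
   [U c]. *)
have subpiece b x : diff_piece U b x -> level b x.
  case=> _; apply: contra_notP => bx.
  have [c [s [cs sb _ sx]]] := level_exit bx.
  exists c; last by rewrite (UE _ _ cs).
  by apply: lt_le_trans sb; case: cs.
exists U; split.
- move=> b _; apply: bigcup_open => s _; apply: closed_openC.
  exact: level_closed.
- apply/seteqP; split=> // x _.
  have [|b [s [bs sa bx sx]]] := @level_exit a x; first by rewrite a0.
  exists b; first by apply: lt_le_trans sa; case: bs.
  split; first by rewrite (UE _ _ bs).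
  move=> [c /= cb [s' [_ cP] /=]]; apply.
  by apply: level_anti bx; exact: cP.
- move=> b ba; have [s bs _] := ord_succ_ex wf ba.
  apply/subspace_continuousP => x bx; have lbx := subpiece _ _ bx.
  apply: cvg_trans (_ : f @ within (level b) (nbhs x) --> f x).
    by apply: cvg_app; apply: within_subset; exact: subpiece.
  apply/(subspace_continuous_atP f _ _ lbx).
  (* A discontinuity at [x] would put [x] into the level of [s], which [U b] excludes. *)
  apply: contrapT => nfx; have [+ _] := bx; rewrite (UE _ _ bs); apply.
  by rewrite (level_succ _ _ bs); apply: subset_closure; split.
Qed.

Lemma piecewise_level a : diff_piecewise_continuous a f -> level a = set0.
Proof.
move=> [U [oU UT cU]].
suff sub b : b <= a -> level b `<=` ~` \bigcup_(c in [set c | c < b]) U c.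
  apply/seteqP; split=> // x /(sub _ (lexx a)); apply.
  have : [set: X] x by [].
  by rewrite UT => -[b ba [Ub _]]; exists b.
apply: (level_ind (fun b L => b <= a ->
  L `<=` ~` \bigcup_(c in [set c | c < b]) U c)) b => {}b.
- by move=> b0 _ x _ [c /=]; rewrite ltNge b0.
- move=> s [bs sP] IHb sa; have ba : b < a := lt_le_trans bs sa.
  (* The complement is closed because [U c] is open for every [c < a], so it suffices to place the
     discontinuities in it, not their closure. *)
  rewrite [X in _ `<=` X](iffLR (closure_id _)); last first.
    apply: open_closedC; apply: bigcup_open => c cs; apply: oU.
    exact: lt_le_trans sa.
  apply: closureS => x [bx nfx] [c /= cs Ucx]; apply: nfx.
  have := IHb (ltW ba) x bx => nUx.
  have cb : c = b.
    apply/le_anti/andP; split; rewrite leNgt; apply/negP.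
      by move=> /sP; rewrite leNgt cs.
    by move=> cb; apply: nUx; exists c.
  rewrite {}cb in Ucx.
  (* By induction, the part of level [b] inside the open set [U b] is contained in the piece of [b],
     so continuity passes from the piece to the level. *)
  have bxU : diff_piece U b x by split.
  apply/(subspace_continuous_atP f _ _ bx) => V fxV.
  have fV := iffLR (subspace_continuousP _ _) (cU b ba) x bxU V fxV.
  have nU := open_nbhs_nbhs (conj (oU _ ba) Ucx).
  have {}fV : nbhs x [set y | diff_piece U b y -> V (f y)] := fV.
  suff : nbhs x [set y | level b y -> V (f y)] by [].
  apply: filterS2 fV nU => y fVy Uby Lby; apply: fVy.
  by split=> //; exact: IHb (ltW ba) y Lby.
(* Below a limit, the successor of [c] is still below [b], and its level already avoids [U c]. *)
- move=> _ bS IH ba x bx [c /= cb Ucx].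
  have [s cs sb] := ord_succ_ex wf cb.
  have {}sb : s < b.
    by rewrite lt_neqAle sb andbT; apply/eqP => sE; apply: bS; exists c; rewrite -sE.
  apply: (IH s sb (le_trans (ltW sb) ba) x (bx s sb)).
  by exists c => //; case: cs.
Qed.

End LevelTheory.

(** * From jump realizers to levels *)

(** This says that [rho] is an open map on its domain. *)
Definition open_prep {X : topologicalType} (rho : baire -> option X) :=
  forall p x U, rho p = Some x -> nbhs p U ->
    nbhs x [set y | exists2 q, U q & rho q = Some y].

Lemma second_countable_enum {X : topologicalType} : @second_countable X ->
  exists e : nat -> set X, (forall n, open (e n)) /\
    forall x U, nbhs x U -> exists2 n, e n x & e n `<=` U.
Proof.
move=> [B /countable_injP[c c_inj] [B_open B_basis]].
(* A number coding no basic set gets the empty union; by injectivity any other number gets exactly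
   one set. *)
exists (fun n => \bigcup_(A in [set A | B A /\ c A = n]) A); split=> [n|x U].
  by apply: bigcup_open => A [/B_open].
move=> /(B_basis x)[A [BA Ax] AU]; exists (c A); first by exists A.
move=> y [A' [BA' cA'] A'y]; apply: AU; rewrite (_ : A = A') //.
by apply: c_inj; rewrite ?inE.
Qed.

Lemma kolmogorov_nbhs_inj {X : topologicalType} (x y : X) :
  kolmogorov_space X -> nbhs x = nbhs y -> x = y.
Proof.
move=> X0 xy; apply: contrapT => /eqP /X0[A]; rewrite xy !inE.
by case=> -[/[dup]]; rewrite -{1}xy => /nbhs_singleton Ax /nbhs_singleton Ay;
  apply.
Qed.

(** A prefix of a name lists finitely many basic open sets, and every point of their intersection
    has a name with that prefix; hence openness. *)
Lemma open_representation {X : topologicalType} :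
  @second_countable X -> kolmogorov_space X ->
  exists delta : baire -> option X,
    [/\ pcontinuous delta, representation delta & open_prep delta].
Proof.
move=> /second_countable_enum[e [oe eP]] X0.
(* p names x when its nonzero entries are the n.+1 with x in e n *)
pose name (p : baire) x := forall n, e n x <-> exists m, p m = n.+1.
have name_inj p x y : name p x -> name p y -> x = y.
  move=> px py; apply: kolmogorov_nbhs_inj => //.
  have sub x' y' : name p x' -> name p y' -> nbhs x' `<=` nbhs y'.
    move=> px' py' U /eP[n /px'/py' eny enU]; apply: filterS enU _.
    exact: open_nbhs_nbhs.
  by apply/seteqP; split; exact: sub.
pose delta (p : baire) := xget None [set Some x | x in name p].
have deltaP p x : delta p = Some x <-> name p x.
  rewrite /delta; split=> [|px].
    by case: xgetP => // _ -> [y py <-] [<-].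
  by apply: xget_unique => [|_ [y py <-]]; [exists x|rewrite (name_inj p x y)].
have delta_near p k x : delta p = Some x ->
    nbhs x [set y | exists2 q, agree k p q & delta q = Some y].
  move=> /deltaP px.
  have : nbhs x [set y | forall m n, (m < k)%N -> p m = n.+1 -> e n y].
    elim: k => [|k IHk]; first exact: filterE.
    case pk : (p k) => [|n].
      apply: filterS IHk => y IHy m n; rewrite ltnS leq_eqVlt.
      by move=> /predU1P[->|/IHy]; [rewrite pk|exact].
    have enx : nbhs x (e n).
      by apply: open_nbhs_nbhs; split=> //; apply/px; exists k.
    apply: filterS2 IHk enx => y IHy eny m n'; rewrite ltnS leq_eqVlt.
    by move=> /predU1P[->|/IHy]; [rewrite pk => -[<-]|exact].
  apply: filterS => y py.
  (* Behind the prefix, position [k + n] lists [e n] if it contains [y] and holds the filler 0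
     otherwise. *)
  exists (fun m => if (m < k)%N then p m else
    if `[< e (m - k)%N y >] then (m - k).+1 else 0%N).
    by move=> i ->.
  apply/deltaP => n; split=> [eny|[m]].
    exists (k + n)%N; rewrite ltnNge leq_addr /= addKn.
    by case: asboolP.
  case: ifPn => [mk pm|_]; first exact: py pm.
  by case: asboolP => // emy [<-].
exists delta; split.
- apply/pcontinuousP => p x /deltaP px V /eP[n enx enV].
  have /px[m pm] := enx.
  apply: filterS (nbhs_cylinder p m.+1) => q pq y /deltaP qy; apply: enV.
  by apply/qy; exists m; rewrite -pq.
- move=> x; exists (fun m => if `[< e m x >] then m.+1 else 0%N).
  apply/deltaP => n; split=> [enx|[m]].
    by exists n; case: asboolP.
  by case: asboolP => // emx [<-].
- move=> p x U px /nbhs_baireP[k kU]; apply: filterS (delta_near _ k _ px).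
  by move=> y [q /kU ? ?]; exists q.
Qed.

Section LevelBound.
Context {X Y : topologicalType} (f : X -> Y).
Context {d : Order.disp_t} {O : orderType d} (wf : well_ordered O).
Variables (delta : baire -> option X) (rhoY : baire -> option Y).
Hypothesis delta_open : open_prep delta.
Hypothesis rhoY_cont : pcontinuous rhoY.
(** [B p n] and [Xi p n] stand for the ordinal and the approximation in block [n] of a realizer's
    output on the name [p]; [B_cont] treats the ordinals as discrete. *)
Variables (B : baire -> nat -> O) (Xi : baire -> nat -> baire).
Hypothesis B_anti : forall p n, pdom delta p -> B p n.+1 <= B p n.
Hypothesis Xi_change : forall p n, pdom delta p ->
  Xi p n <> Xi p n.+1 -> B p n <> B p n.+1.
Hypothesis B_cont : forall p n, pdom delta p ->
  nbhs p [set q | pdom delta q -> B q n = B p n].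
Hypothesis Xi_cont : forall p n V, pdom delta p -> nbhs (Xi p n) V ->
  nbhs p [set q | pdom delta q -> V (Xi q n)].
Hypothesis Xi_lim : forall p x n, delta p = Some x ->
  (forall m, (n <= m)%N -> Xi p m = Xi p n) -> rhoY (Xi p n) = Some (f x).

Lemma level_bound a x p n : level f wf a x -> delta p = Some x -> a <= B p n.
Proof.
suff: forall x, level f wf a x -> forall p n, delta p = Some x -> a <= B p n.
  by move=> H ax px; exact: H ax _ _ px.
move: a {x p n}.
apply: (level_ind f wf (fun a L => forall x, L x -> forall p n,
  delta p = Some x -> a <= B p n)).
- by move=> a a0 *; exact: a0.
- move=> b a [ba sP] IHb x clx p n px; rewrite leNgt; apply/negP => Bpa.
  have pD : pdom delta p by exists x.
  (* By openness, the points with a name near [p] fill a neighborhood of [x], so one of them is a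
     discontinuity [y]. *)
  have [y [[Ly ny] [q /= Bqp qy]]] := clx _ (delta_open _ _ _ px (B_cont p n pD)).
  have qD : pdom delta q by exists y.
  have Bqb : B q n = b.
    apply/le_anti; rewrite (IHb y Ly q n qy) andbT leNgt; apply/negP => /sP.
    by rewrite Bqp // leNgt Bpa.
  (* Once the ordinal has reached b on a name of a point of the b-th level, it
     stays there, so the current approximation is already the limit. *)
  have final q' y' : delta q' = Some y' -> level f wf b y' -> B q' n = b ->
      rhoY (Xi q' n) = Some (f y').
    move=> qy' Ly' Bq'; have q'D : pdom delta q' by exists y'.
    have Bm k : B q' (n + k)%N = b.
      elim: k => [|k IHk]; first by rewrite addn0.
      apply/le_anti; rewrite (IHb y' Ly' _ _ qy') andbT -[leRHS]IHk addnS.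
      exact: B_anti.
    apply: (Xi_lim _ _ _ qy') => m /subnKC <-.
    elim: (m - n)%N => [|k IHk]; first by rewrite addn0.
    rewrite -IHk addnS; apply/esym; apply: contrapT => /(Xi_change _ _ q'D).
    by rewrite -addnS !Bm.
  (* Names near [q] of points of the level also have ordinal [b], so [final] applies to them too,
     and continuity of [Xi _ n] carries over to [f]. *)
  apply: ny; apply/(subspace_continuous_atP f _ _ Ly) => V fyV.
  have Vq := iffLR (pcontinuousP _) rhoY_cont _ _ (final _ _ qy Ly Bqb) V fyV.
  have nV := delta_open _ _ _ qy
    (@filterI _ (nbhs q) (nbhs_filter q) _ _ (B_cont q n qD) (Xi_cont q n _ qD Vq)).
  suff : nbhs y [set y' | level f wf b y' -> V (f y')] by [].
  apply: filterS nV => y' [q' [Bq' Vq'] qy'] Ly'.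
  have q'D : pdom delta q' by exists y'.
  by apply: (Vq' q'D); apply: final => //; rewrite Bq'.
- move=> a a0 aS IH x Lx p n px; rewrite leNgt; apply/negP => Ba.
  have [s [Bs sP] sa] := ord_succ_ex wf Ba.
  have {}sa : s < a.
    rewrite lt_neqAle sa andbT; apply/eqP => sE; apply: aS.
    by exists (B p n); rewrite -sE; split.
  have := IH s sa x (Lx s sa) p n px.
  by rewrite leNgt Bs.
Qed.

End LevelBound.

Section JumpTheory.
Context {d : Order.disp_t} {O : orderType d}.
Variables (enc : baire_seq -> baire) (a : O) (code : O -> nat).
Hypothesis enc_seq : seq_encoding enc.
Hypothesis code_inj : set_inj [set b | b < a] code.

(** The graph is functional: decoding recovers the blocks, [tail] strips off the ordinal, and limits
    in Baire space are unique. *)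
Lemma jump_graphP p q : jump enc a code p = Some q <-> jump_graph enc a code p q.
Proof.
have [_ [dec [decK _ _]]] := enc_seq.
rewrite /jump; split=> [|pq]; first by case: xgetP => // _ -> [y py <-] [<-].
apply: xget_unique => [|_ [r pr <-]]; first by exists q.
case: pq pr => b [xi [ba _ -> xiq]] [b' [xi' [ba' _ /(can_inj decK) E xir]]].
have xiE : xi = xi'.
  by apply/funext => n; move/(congr1 (fun s : baire_seq => tail (s n))): E.
congr Some; rewrite -xiE in xir.
exact: (cvg_unique baire_hausdorff xir xiq).
Qed.

(** Admissibility of [rhoX] translates names in an open representation into [rhoX]-names, on which
    the given realizer runs. *)
Lemma jump_level {X Y : topologicalType}
    (rhoX : baire -> option X) (rhoY : baire -> option Y) (f : X -> Y)
    (wf : well_ordered O) :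
  @second_countable X -> kolmogorov_space X -> admissible rhoX ->
  pcontinuous rhoY -> jump_realizable enc a code rhoX rhoY f ->
  level f wf a = set0.
Proof.
move=> X2 X0 [_ _ rhoX_adm] rhoY_cont [F F_cont FE].
have [delta [delta_cont delta_surj delta_open]] := open_representation X2 X0.
have [G G_cont GE] := rhoX_adm _ delta_cont.
have H_cont := pcontinuous_comp _ _ G_cont F_cont.
set H := obind F \o G in H_cont.
have [_ [dec [decK _ dec_cont]]] := enc_seq.
(* [D p] holds the ordinals and approximations encoded in the output on [p]; off the domain of
   [delta] its value is arbitrary. *)
have /choice[D DP] : forall p, exists D : (nat -> O) * baire_seq,
    forall x, delta p = Some x -> exists v,
    [/\ H p = Some (enc (fun n => prepend (code (D.1 n)) (D.2 n))),
        forall n, D.1 n < a /\ D.1 n.+1 <= D.1 n,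
        forall n, D.2 n <> D.2 n.+1 -> D.1 n <> D.1 n.+1,
        D.2 @ \oo --> v & rhoY v = Some (f x)].
  move=> p; case px : (delta p) => [x|]; last by exists (fun=> a, fun=> p).
  have := px; rewrite GE /=; case Gp : (G p) => [p'|//] /= p'x.
  have := congr1 (fun g => g p') FE; rewrite /= p'x /=.
  case Fp' : (F p') => [z|//] /=; case jz : (jump _ _ _ z) => [v|//] /= /esym vx.
  have [b [xi [ba xib zE xiv]]] := iffLR (jump_graphP _ _) jz.
  exists (b, xi) => _ [<-]; exists v; split=> //.
  by rewrite /H /= Gp /= Fp' zE.
pose S p : baire_seq := fun n => prepend (code ((D p).1 n)) ((D p).2 n).
have HS p : pdom delta p -> H p = Some (enc (S p)).
  by move=> [x /DP[v []]].
have S_cont p n V : pdom delta p -> nbhs (S p n) V ->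
    nbhs p [set q | pdom delta q -> V (S q n)].
  move=> pD SV.
  have dV : nbhs (enc (S p)) [set z | V (dec z n)].
    have := iffLR (cvg_prod_topology _ _ _) (dec_cont (enc (S p))) n.
    by rewrite decK; exact.
  have := iffLR (pcontinuousP _) H_cont _ _ (HS _ pD) _ dV.
  by apply: filterS => q qV qD; have := qV _ (HS _ qD); rewrite /= decK.
apply/seteqP; split=> // x ax.
have [p px] := delta_surj x.
(* The level bound puts the first ordinal at [a] or above, against the domain of the jump. *)
have : a <= (D p).1 0%N.
  apply: (level_bound f wf delta rhoY delta_open rhoY_cont
    (fun p => (D p).1) (fun p => (D p).2)) ax px.
  - by move=> q n [y /DP[v [_ Da _ _ _]]]; have [] := Da n.
  - by move=> q n [y /DP[v [_ _ + _ _]]]; exact.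
  (* Length 1 is enough: a block starts with the code of its ordinal, and [code] is injective below
     [a]. *)
  - move=> q n qD; have := S_cont q n _ qD (nbhs_cylinder _ 1).
    apply: filterS => r rS rD; have /(_ 0%N isT) /= E := rS rD.
    have [[y /DP[v [_ Da _ _ _]]] [z /DP[w [_ Da' _ _ _]]]] := (qD, rD).
    by apply/esym; apply: code_inj; rewrite ?inE //=;
      [have [] := Da n|have [] := Da' n].
  - move=> q n V qD xiV.
    have : nbhs (S q n) [set r | V (tail r)] by apply: tail_continuous.
    by move=> /(S_cont q n _ qD).
  - move=> q y n qy const; have [v [_ _ _ xiv vy]] := DP _ _ qy.
    suff -> : (D q).2 n = v by []. apply: (cvg_unique baire_hausdorff _ xiv).
    by apply: cvg_near_cst; exists n => // m nm; exact: const.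
have [v [_ Da _ _ _]] := DP _ _ px.
by rewrite leNgt; have [->] := Da 0%N.
Qed.

End JumpTheory.

(** * From difference pieces to jump realizers *)

Lemma closure_baireP (A : set baire) (p : baire) :
  closure A p <-> forall n, exists2 q, A q & agree n p q.
Proof.
split=> [clp n|Ap V /nbhs_baireP[n nV]].
  by have [q [Aq pq]] := clp _ (nbhs_cylinder p n); exists q.
by have [q Aq pq] := Ap n; exists q; split=> //; exact: nV.
Qed.

(* A point off the closure of A goes to a point of A chosen in the smallest
   cylinder around it that meets A. *)
Lemma closure_retraction (A : set baire) : A !=set0 ->
  exists r : baire -> baire, [/\ continuous r,
    forall p, closure A p -> r p = p & forall p, ~ closure A p -> A (r p)].
Proof.
move=> [a0 Aa0]; pose meets n p := exists2 q, A q & agree n p q.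
have meets_agree n k p q : (n <= k)%N -> agree k p q -> meets n p -> meets n q.
  move=> nk pq [s As ps]; exists s => //.
  by apply: agree_trans ps; apply: agree_sym; apply: agreeS pq.
pose last_meet p n := meets n p /\ ~ meets n.+1 p.
pose depth p := xget 0%N (last_meet p).
pose r p := if `[< closure A p >] then p
  else xget a0 [set q | A q /\ agree (depth p) p q].
have depthP p : ~ closure A p -> last_meet p (depth p).
  move=> clp; apply: xgetPex; apply: contrapT => nlast.
  apply/clp/closure_baireP; elim=> [|n IHn]; first by exists a0.
  by apply: contrapT => nm; apply: nlast; exists n.
have depth_unique p n : last_meet p n -> depth p = n.
  have last_le i j : last_meet p i -> last_meet p j -> (i <= j)%N.
    move=> [[q Aq pq] _] [_ nj]; rewrite leqNgt; apply/negP => ji.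
    by apply: nj; exists q => //; apply: agreeS pq.
  move=> pn; apply: xget_unique => // m pm.
  by apply/eqP; rewrite eqn_leq !last_le.
have rP p : ~ closure A p -> A (r p) /\ agree (depth p) p (r p).
  move=> clp; rewrite /r; case: asboolP => // _.
  have [[q Aq pq] _] := depthP _ clp.
  by apply: (xgetPex a0 (P := [set q | A q /\ agree (depth p) p q])); exists q.
have r_id p : closure A p -> r p = p by move=> clp; rewrite /r asboolT.
exists r; split=> // [p V|p /rP[]//].
have [clp|clp] := pselect (closure A p); last first.
  move=> /nbhs_singleton Vrp.
  (* A point sharing one entry more than the depth has the same depth and the same candidates, so
     [xget] makes the same choice: [r] is locally constant here. *)
  have [mp nmp] := depthP _ clp.
  apply: filterS (nbhs_cylinder p (depth p).+1) => q pq /=.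
  have qp := agree_sym _ pq.
  have nmq : ~ meets (depth p).+1 q by move=> /(meets_agree _ _ _ _ (leqnn _) qp).
  have mq : meets (depth p) q by apply: meets_agree mp; [|exact: pq].
  have dq : depth q = depth p by apply: depth_unique; split.
  have clq : ~ closure A q by move=> /closure_baireP /(_ (depth p).+1).
  suff -> : r q = r p by [].
  rewrite /r; do 2 case: asboolP => // _; rewrite dq; congr xget.
  have pq' := agreeS _ _ (leqnSn (depth p)) pq.
  apply/seteqP; split=> s [As] st; split=> //.
    exact: agree_trans pq' st.
  exact: agree_trans (agree_sym _ pq') st.
rewrite r_id // => /nbhs_baireP[k kV]; apply: filterS (nbhs_cylinder p k).
(* Every cylinder around [p] meets [A], so a [q] off the closure that agrees with [p] up to [k] has
   depth at least [k]. *)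
move=> q pq; apply: kV; apply: (agree_trans _ pq).
have [clq|clq] := pselect (closure A q); first by rewrite r_id.
have [_ qr] := rP _ clq; apply: agreeS qr; rewrite leqNgt; apply/negP => dk.
have [_] := depthP _ clq; apply.
by apply: (meets_agree _ k p) => //; move/closure_baireP: clp; exact.
Qed.

(** The retraction onto the closure of [A] maps [D] into [A], because [A] is relatively closed in
    [D]; [h] is [G] after this retraction. *)
Lemma relatively_closed_extension (D A : set baire) (G : baire -> option baire) :
  pcontinuous G -> A `<=` pdom G -> D `&` closure A `<=` A ->
  exists h : baire -> baire, (forall p, A p -> G p = Some (h p)) /\
    forall p V, D p -> nbhs (h p) V -> nbhs p [set q | D q -> V (h q)].
Proof.
move=> G_cont AG DA; have [A0|A0] := pselect (A !=set0); last first.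
  exists (fun=> point); split=> [p Ap|p V _ /nbhs_singleton Vp].
    by case: A0; exists p.
  by apply: (@filterE _ (nbhs p)) => q _.
have [r [r_cont r_id rA]] := closure_retraction A A0.
have DrA p : D p -> A (r p).
  move=> Dp; have [clp|/rA//] := pselect (closure A p).
  by rewrite r_id //; apply: DA.
exists (fun p => odflt point (G (r p))); split=> [p Ap|p V /DrA /AG[z Gz]].
  by rewrite r_id; [have [z ->] := AG _ Ap|exact: subset_closure].
rewrite Gz /= => zV.
have rV : nbhs p [set q | forall z', G (r q) = Some z' -> V z'].
  exact: r_cont p _ (iffLR (pcontinuousP _) G_cont _ _ Gz _ zV).
by apply: filterS rV => q Vq /DrA /AG[z' Gz']; rewrite Gz' /=; exact: Vq.
Qed.

Lemma nat_well_ordered : well_ordered nat.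
Proof. by elim/ltn_ind => n IHn; constructor => m; exact: IHn. Qed.

Section PiecewiseJump.
Context {X Y : topologicalType} (f : X -> Y).
Context {d : Order.disp_t} {O : orderType d} (wf : well_ordered O).
Variables (a : O) (U : O -> set X).
Hypothesis U_open : forall b, b < a -> open (U b).
Hypothesis U_cover : [set: X] = \bigcup_(b in [set b | b < a]) diff_piece U b.
Hypothesis f_cont : forall b, b < a -> {within diff_piece U b, continuous f}.
Variables (rhoX : baire -> option X) (rhoY : baire -> option Y).
Hypothesis rhoX_cont : pcontinuous rhoX.
Hypothesis rhoY_adm : admissible rhoY.

(** The piece is [U b] minus open sets, so its names are relatively closed among the names of points
    of [U b], and a realizer on the piece extends. *)
Lemma piece_realizer b : b < a -> exists h : baire -> baire,
  (forall p x, rhoX p = Some x -> diff_piece U b x ->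
     rhoY (h p) = Some (f x)) /\
  (forall p V, ppreimage rhoX (U b) p -> nbhs (h p) V ->
     nbhs p [set q | ppreimage rhoX (U b) q -> V (h q)]).
Proof.
move=> ba.
pose g p := if rhoX p is Some x then
  if `[< diff_piece U b x >] then Some (f x) else None else None.
have g_cont : pcontinuous g.
  apply/pcontinuousP => p y; rewrite {1}/g; case px : (rhoX p) => [x|//].
  case: asboolP => // bx [<-] V fxV.
  have fV : nbhs x [set x' | diff_piece U b x' -> V (f x')].
    exact: (iffLR (subspace_continuousP _ _) (f_cont b ba) x bx V fxV).
  have := iffLR (pcontinuousP _) rhoX_cont _ _ px _ fV.
  apply: filterS => q qV z; rewrite /g; case qx : (rhoX q) => [x'|//].
  by case: asboolP => // bx' [<-]; exact: qV.
have [_ _ /(_ g g_cont)[G G_cont GE]] := rhoY_adm.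
have gE p x : rhoX p = Some x -> diff_piece U b x ->
    obind rhoY (G p) = Some (f x).
  move=> px bx; rewrite -[LHS]/((obind rhoY \o G) p) -GE /g px.
  by case: asboolP.
have [p [x px bx]|p [[x px Ubx] clp]|h [hG h_cont]] :=
    relatively_closed_extension (ppreimage rhoX (U b))
      (ppreimage rhoX (diff_piece U b)) G G_cont.
- by have := gE _ _ px bx; case Gp : (G p) => [z|//] _; exists z.
- exists x => //; split=> // -[c /= cb Ucx].
  have cV := open_nbhs_nbhs (conj (U_open c (lt_trans cb ba)) Ucx).
  have [q [[z qz [_ nUz]] Uq]] :=
    clp _ (iffLR (pcontinuousP _) rhoX_cont _ _ px _ cV).
  by apply: nUz; exists c => //; exact: Uq.
- exists h; split=> // p x px bx.
  have := gE _ _ px bx; rewrite hG //; last by exists x.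
Qed.

Definition certified m (p : baire) : set O :=
  [set b | b < a /\ forall q, agree m p q -> forall x, rhoX q = Some x -> U b x].

Lemma certified_mono m n p : (m <= n)%N -> certified m p `<=` certified n p.
Proof.
by move=> mn b [ba bU]; split=> // q pq; apply: bU; exact: agreeS mn pq.
Qed.

Lemma certified_agree m n p q : (m <= n)%N -> agree n p q ->
  certified m q = certified m p.
Proof.
move=> mn /(agreeS _ _ mn) pq.
apply/seteqP; split=> b [ba bU]; split=> // s ?; apply: bU.
  exact: agree_trans (agree_sym _ pq) _.
exact: agree_trans pq _.
Qed.

Lemma certified_ex p x b : rhoX p = Some x -> b < a -> U b x ->
  exists m, certified m p b.
Proof.
move=> px ba Ux; have UV := open_nbhs_nbhs (conj (U_open b ba) Ux).
have /nbhs_baireP[m mU] := iffLR (pcontinuousP _) rhoX_cont _ _ px _ UV.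
by exists m; split=> // q /mU.
Qed.

Lemma cover_ex x : exists2 b, b < a & U b x.
Proof.
have : [set: X] x by [].
by rewrite U_cover => -[b ba [Ux _]]; exists b.
Qed.

(** Shorter prefixes may certify no index at all, and then there would be no ordinal below [a] to
    output. *)
Definition delay p : nat := least 0%N [set m | certified m p !=set0].

Definition guess n p : O := least a (certified (delay p + n) p).

Lemma delayP p : pdom rhoX p -> certified (delay p) p !=set0 /\
  forall m, certified m p !=set0 -> (delay p <= m)%N.
Proof.
move=> [x px]; apply: (leastP nat_well_ordered).
have [b ba Ux] := cover_ex x.
by have [m bm] := certified_ex _ _ _ px ba Ux; exists m; exists b.
Qed.

Lemma guessP n p : pdom rhoX p -> certified (delay p + n) p (guess n p) /\
  forall b, certified (delay p + n) p b -> guess n p <= b.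
Proof.
move=> /delayP[[b bp] _]; apply: (leastP wf).
by exists b; apply: certified_mono bp; exact: leq_addr.
Qed.

(** Both the delay and the certified indices are read off the first [delay p + n] entries, so the
    guess is locally constant on names. *)
Lemma guess_agree n p q : pdom rhoX p -> agree (delay p + n) p q ->
  guess n q = guess n p.
Proof.
move=> pD pq; have [dp dP] := delayP _ pD.
have dE : delay q = delay p.
  apply: (least_unique nat_well_ordered) => [|m] /=.
    by rewrite (certified_agree _ _ _ _ _ pq) // leq_addr.
  move=> mq; rewrite leNgt; apply/negP => /[dup] /ltW mp.
  rewrite ltNge => /negP; apply; apply: dP.
  by rewrite -(certified_agree _ _ _ _ _ pq) // (leq_trans mp) // leq_addr.
by rewrite /guess dE (certified_agree _ _ _ _ (leqnn _) pq).
Qed.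

Lemma guess_cover n p x : rhoX p = Some x -> guess n p < a /\ U (guess n p) x.
Proof.
move=> px; have [|[ga gU] _] := guessP n p; first by exists x.
by split=> //; exact: gU px.
Qed.

Lemma guess_anti n p : pdom rhoX p -> guess n.+1 p <= guess n p.
Proof.
move=> pD; have [gn _] := guessP n p pD; have [_] := guessP n.+1 p pD; apply.
by apply: certified_mono gn; rewrite addnS.
Qed.

(** The limit is the least [b < a] with [x] in [U b]: no guess is smaller, since certified sets do
    contain [x], and [b] is the guess once it is certified. *)
Lemma guess_eventually p x : rhoX p = Some x ->
  exists b, [/\ b < a, diff_piece U b x &
    exists k, forall n, (k <= n)%N -> guess n p = b].
Proof.
move=> px; have pD : pdom rhoX p by exists x.
have [b [[ba Ux] bP]] : exists b, (b < a /\ U b x) /\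
    forall c, c < a /\ U c x -> b <= c.
  apply: (wo_least wf [set b | b < a /\ U b x]).
  by have [b ba Ux] := cover_ex x; exists b.
exists b; split=> //.
  split=> // -[c /= cb Uc].
  by have := bP c (conj (lt_trans cb ba) Uc); rewrite leNgt cb.
have [k kb] := certified_ex _ _ _ px ba Ux; exists k => n kn.
have [_ gP] := guessP n p pD; apply/le_anti/andP; split.
  by apply: gP; apply: certified_mono kb; rewrite (leq_trans kn) ?leq_addl.
by apply: bP; exact: guess_cover px.
Qed.

Variables (enc : baire_seq -> baire) (code : O -> nat).
Hypothesis enc_seq : seq_encoding enc.

Lemma piecewise_jump : jump_realizable enc a code rhoX rhoY f.
Proof.
have /choice[h hP] : forall b, exists h : baire -> baire, b < a ->
  (forall p x, rhoX p = Some x -> diff_piece U b x ->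
     rhoY (h p) = Some (f x)) /\
  (forall p V, ppreimage rhoX (U b) p -> nbhs (h p) V ->
     nbhs p [set q | ppreimage rhoX (U b) q -> V (h q)]).
  move=> b; have [ba|ba] := boolP (b < a); last by exists id.
  by have [h hP] := piece_realizer b ba; exists h.
pose xi (p : baire) : baire_seq := fun n => h (guess n p) p.
pose s (p : baire) : baire_seq := fun n => prepend (code (guess n p)) (xi p n).
exists (fun p => if p \in pdom rhoX then Some (enc (s p)) else None).
  apply: (continuous_pcontinuous (pdom rhoX) (enc \o s)) => // p [x px].
  have pD : pdom rhoX p by exists x.
  apply: (cvg_comp s enc) (enc_seq.1 (s p)).
  have pF : Filter (within (pdom rhoX) (nbhs p)).
    exact: within_filter (nbhs_filter p).
  apply: (iffRL (cvg_prod_topology _ (fmap_filter s pF) (s p))) => n V snV.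
  suff : nbhs p [set q | pdom rhoX q -> V (s q n)] by [].
  have [ga gx] := guess_cover n _ _ px.
  have pU : ppreimage rhoX (U (guess n p)) p by exists x.
  have := (hP _ ga).2 _ _ pU (prepend_continuous _ _ _ snV).
  (* On this cylinder the guess is fixed, so block [n] is computed by a single [h b], which is
     continuous on the names of points of [U b]. *)
  apply: filterS2 (nbhs_cylinder p (delay p + n)) => q pq hV [y qy].
  have [_] := guess_cover n _ _ qy.
  rewrite /s /xi (guess_agree _ _ _ pD pq) => gy.
  by apply: hV; exists y.
apply/funext => p /=; case px : (rhoX p) => [x|] /=; last first.
  by rewrite memNset // => -[x]; rewrite px.
have pD : pdom rhoX p by exists x.
rewrite mem_set //=.
have [b [ba bx [k kb]]] := guess_eventually _ _ px.
rewrite (iffRL (jump_graphP enc a code enc_seq _ (h b p))) /=.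
  by rewrite ((hP b ba).1 p x).
exists (fun n => guess n p), (xi p); split=> //.
- by move=> n; split; [case: (guess_cover n _ _ px)|exact: guess_anti].
- by move=> n; apply: contra_not => E; rewrite /xi E.
- by apply: cvg_near_cst; exists k => // n /= kn; rewrite /xi kb.
Qed.

End PiecewiseJump.

Theorem theorem21
  (X Y : topologicalType)
  (X_countably_based : @second_countable X) (X_T0 : kolmogorov_space X)
  (Y_countably_based : @second_countable Y) (Y_T0 : kolmogorov_space Y)
  (rhoX : baire -> option X) (rhoX_admissible : admissible rhoX)
  (rhoY : baire -> option Y) (rhoY_admissible : admissible rhoY)
  (enc : baire_seq -> baire) (enc_seq : seq_encoding enc)
  (d : Order.disp_t) (O : orderType d) (wfO : well_ordered O)
  (alpha : O) (alpha_countable : countable [set b | b < alpha])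
  (alpha_ge1 : ~ ord_zero alpha)
  (code : O -> nat) (code_inj : set_inj [set b | b < alpha] code)
  (f : X -> Y) :
  (jump_realizable enc alpha code rhoX rhoY f <-> Lev_le f wfO alpha) /\
  (Lev_le f wfO alpha <-> diff_piecewise_continuous alpha f).
Proof.
have [_ rhoX_cont _] := rhoX_admissible.
have [_ rhoY_cont _] := rhoY_admissible.
rewrite Lev_leP; split; split.
- exact: jump_level.
- move=> /level_piecewise[U [U_open U_cover f_cont]].
  exact: (piecewise_jump f wfO alpha U).
- exact: level_piecewise.
- exact: piecewise_level.
Qed.
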